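(* Let $G$ be a graph on a linearly ordered set of edges $E$, and let $\vec G$ be an orientation of $G$. Then $$t(G;x+u,y+v)=\sum_{A\subseteq E}x^{|\Theta^*_{\vec G}(A)|}\,u^{|\bar\Theta^*_{\vec G}(A)|}\,y^{|\Theta_{\vec G}(A)|}\,v^{|\bar\Theta_{\vec G}(A)|}.$$
   Context: Graphs are finite, connected, and may have loops and multiple edges. $t(G;x,y)$ is the Tutte polynomial of $G$: $t(G;x,y)=\sum_{\iota,\varepsilon}t_{\iota,\varepsilon}x^\iota y^\varepsilon$, where $t_{\iota,\varepsilon}$ is the number of spanning trees with internal activity $\iota$ and external activity $\varepsilon$ (for a spanning tree $T$, the internal activity is the number of $b\in T$ that are smallest in their fundamental cocycle, the external activity is the number of $e\notin T$ that are smallest in their fundamental cycle). For $A\subseteq E$, $-_A\vec G$ is the digraph obtained from $\vec G$ by reversing the edges in $A$. Cycles and cocycles (inclusion-minimal non-empty edge cuts) are edge subsets; a cycle is directed if its edges are consistently oriented along it, a cocycle is directed if all its edges go from one side of the cut to the other. For an ordered digraph $\vec H$, $O(\vec H)$ is the set of smallest edges of directed cycles of $\vec H$, and $O^*(\vec H)$ is the set of smallest edges of directed cocycles of $\vec H$. Define, for $A\subseteq E$: $\Theta_{\vec G}(A)=O(-_A\vec G)\setminus A$, $\bar\Theta_{\vec G}(A)=O(-_A\vec G)\cap A$, $\Theta^*_{\vec G}(A)=O^*(-_A\vec G)\setminus A$, $\bar\Theta^*_{\vec G}(A)=O^*(-_A\vec G)\cap A$. *)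

(* Defs.v *)
From mathcomp Require Import all_boot all_order all_algebra.
From mathcomp Require Import mpoly.

Set Implicit Arguments.
Unset Strict Implicit.
Unset Printing Implicit Defensive.

Import Order.TTheory GRing.Theory.
Local Open Scope ring_scope.

(* Loops have a single end, and distinct edges may have the same ends. *)
Record mgraph (V E : finType) := MGraph {
  ends : E -> {set V};
  ends_card : forall e, (0 < #|ends e| <= 2)%N
}.

Record digraph (V E : finType) := Digraph {
  src : E -> V;
  tgt : E -> V
}.

Section Graphs.
Variables (V E : finType).
Implicit Types (G : mgraph V E) (D : digraph V E) (S : {set V}).
Implicit Types (A C T : {set E}).

Definition orientation G D : Prop := forall e, ends G e = [set src D e; tgt D e].

Lemma underlying_subproof D e : (0 < #|[set src D e; tgt D e]| <= 2)%N.
Proof. by rewrite cards2; case: eqP. Qed.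

Definition underlying D : mgraph V E := MGraph (underlying_subproof D).

Definition reorient A D : digraph V E := {|
  src := fun e => if e \in A then tgt D e else src D e;
  tgt := fun e => if e \in A then src D e else tgt D e
|}.

Definition adjacent G A : rel V :=
  fun v w => [exists e in A, ends G e == [set v; w]].

Definition connects G A : bool := [forall v, forall w, connect (adjacent G A) v w].

Definition connected G : bool := connects G [set: E].

(* [step v e w] says that e may be traversed from v to w. C is the edge set of
   a closed walk (v_1, e_1), ..., (v_k, e_k), k > 0, back to v_1, with distinct
   vertices and distinct edges: k = 1 is a loop, k = 2 a pair of parallel edges.
   Distinctness of the edges gives the bound k <= #|E|. *)
Definition circuit (step : V -> E -> V -> bool) C : bool :=
  [exists p : {bseq #|E| of V * E},
    [&& p != [::] :> seq _,
        cycle (fun s s' => step s.1 s.2 s'.1) p,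
        uniq [seq s.1 | s <- p], uniq [seq s.2 | s <- p]
      & C == [set e | e \in [seq s.2 | s <- p]]]].

Definition gcycle G C : bool := circuit (fun v e w => ends G e == [set v; w]) C.

(* A directed closed walk is in particular a closed walk of the underlying
   graph, so these are cycles of [underlying D]. *)
Definition directed_cycle D C : bool :=
  circuit (fun v e w => (src D e == v) && (tgt D e == w)) C.

Definition cut G S : {set E} :=
  [set e | ~~ (ends G e \subset S) && ~~ (ends G e \subset ~: S)].

Definition cocycle G C : bool :=
  minset (fun B : {set E} => (B != set0) && [exists S, B == cut G S]) C.

Definition directed_cocycle D C : bool :=
  cocycle (underlying D) C &&
  [exists S, (C == cut (underlying D) S) &&
             [forall e in C, (src D e \in S) && (tgt D e \notin S)]].

Definition spanning_tree G T : bool :=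
  connects G T && [forall C : {set E}, (C \subset T) ==> ~~ gcycle G C].

(* For a spanning tree T, the pick is over a singleton when e \notin T
   (resp. b \in T); the default set0 is then not used. *)
Definition fund_cycle G T e : {set E} :=
  odflt set0 [pick C : {set E} | gcycle G C && (C \subset e |: T)].

Definition fund_cocycle G T b : {set E} :=
  odflt set0 [pick C : {set E} | cocycle G C && (C \subset b |: ~: T)].

End Graphs.

Section Activities.
Variables (V : finType) (disp : Order.disp_t) (E : finOrderType disp).
Implicit Types (G : mgraph V E) (D : digraph V E) (A C T : {set E}).

Definition smallest C e : bool := (e \in C) && [forall f in C, (e <= f)%O].

Definition int_activity G T : nat := #|[set b in T | smallest (fund_cocycle G T b) b]|.

Definition ext_activity G T : nat := #|[set e in ~: T | smallest (fund_cycle G T e) e]|.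

Definition ntrees G (i j : nat) : nat :=
  #|[set T : {set E} | [&& spanning_tree G T, int_activity G T == i
                         & ext_activity G T == j]]|.

(* Activities are at most #|E|, so no term is lost. *)
Definition tutte G : {mpoly int[2]} :=
  \sum_(i < #|E|.+1) \sum_(j < #|E|.+1)
    (ntrees G i j)%:R * 'X_(@Ordinal 2 0 isT) ^+ i * 'X_(@Ordinal 2 1 isT) ^+ j.

Definition Oset D : {set E} :=
  [set e | [exists C : {set E}, directed_cycle D C && smallest C e]].

Definition Oset_dual D : {set E} :=
  [set e | [exists C : {set E}, directed_cocycle D C && smallest C e]].

Definition Theta D A : {set E} := Oset (reorient A D) :\: A.
Definition Theta_bar D A : {set E} := Oset (reorient A D) :&: A.
Definition Theta_dual D A : {set E} := Oset_dual (reorient A D) :\: A.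
Definition Theta_dual_bar D A : {set E} := Oset_dual (reorient A D) :&: A.

End Activities.

(* Main.v *)
Require Import Defs.
From mathcomp Require Import all_boot all_order all_algebra.
From mathcomp Require Import mpoly.
From mathcomp Require Import ring.

Set Implicit Arguments.
Unset Strict Implicit.
Unset Printing Implicit Defensive.

Import Order.TTheory GRing.Theory.
Local Open Scope ring_scope.

(** Both sides of the identity are the two ends of one interpolation.  Give each
    edge a set of arcs: one of its two directions if it is oriented, none if it
    is deleted, both if it is contracted.  An edge traversed from s to t is the
    smallest edge of a directed cycle iff t reaches s along arcs of larger edges
    ([mem_Oset]), and the smallest edge of a directed cocycle iff t does not
    reach s even when all smaller edges may be traversed both ways
    ([mem_Oset_dual]).  These reachability conditions still make sense when
    edges are deleted or contracted.

    For an up-closed set U of edges and a set A, let the edges of U be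
    contracted or deleted according to A, and let the others be oriented
    according to A.  The weight of this state is a product over the edges e, in
    which e contributes 0, 1, one of the variables, or a sum of two of them,
    according to the two conditions at e.  For U empty this is the monomial of A
    on the right hand side ([total_weight_oriented]); for U the set of all edges
    it is 0 unless A is a spanning tree, and then it is
    (x + u) ^ internal activity * (y + v) ^ external activity
    ([total_weight_tree], [total_weight_disconnected], [total_weight_cyclic]).

    The point is that the sum of the weights over A does not change when the
    largest edge w outside U is moved into U ([total_weight_step]).  Fix the
    state of the other edges.  For an edge e < w from s to t, an arc of w
    matters only if it opens a new route from t to s.  Among the two directions
    of w, one opens no new route, for any e and either condition
    ([through_dichotomy]).  Indeed, the arc sets allowed in the various
    conditions form a chain ([level_chain]); if both directions of w opened a
    new route, the two routes could be spliced, in the larger of the two arc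
    sets, into a route that avoids w.  So one direction of w has the effect of
    deletion on the smaller edges, hence the other one has the effect of
    contraction, and the two sums agree.  If w is a loop or an isthmus then
    neither direction opens a new route, and the two sums agree because the
    contributions y, v (or x, u) of the two directions of w add up to the
    contribution y + v of its deletion (or x + u of its contraction), the other
    minor counting 0. *)

(** * Circuits and reachability *)

Section Circuits.
Variables (V E : finType).
Implicit Types (G : mgraph V E) (step : V -> E -> V -> bool) (A C : {set E}).

Definition via step A : rel V := fun v w => [exists f in A, step v f w].

Lemma via_path step A s z q :
  path (fun s s' : V * E => step s.1 s.2 s'.1) s (rcons q z) ->
  all (fun t => t.2 \in A) q ->
  exists2 b, step s.1 s.2 b & connect (via step A) b z.1.
Proof.
elim: q s => [|t q IHq] s /=; first by rewrite andbT => sz _; exists z.1.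
case/andP=> st pt /andP[tA qA]; exists t.1 => //.
have [b tb bz] := IHq _ pt qA; apply: connect_trans bz.
by apply/connect1/exists_inP; exists t.2.
Qed.

Lemma circuit_connect step C e : circuit step C -> e \in C ->
  exists a b, step a e b /\ connect (via step (C :\ e)) b a.
Proof.
case/existsP=> p /and5P[_ cyc_p _ uniq_p /eqP->].
rewrite inE => /mapP[s /rot_to[i q Eq] ->] {e}.
have mem_q : [seq t.2 | t <- p] =i s.2 :: [seq t.2 | t <- q].
  by move=> f; rewrite -(mem_rot i) -map_rot Eq.
move: cyc_p uniq_p; rewrite -(rot_cycle i) -(rot_uniq i) -map_rot Eq /=.
move=> path_q /andP[sNq _].
have [|b sb bs] := via_path (A := [set f | f \in [seq t.2 | t <- p]] :\ s.2) path_q.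
  apply/allP=> t tq; have t2q : t.2 \in [seq t.2 | t <- q] by apply: map_f.
  by rewrite !inE mem_q inE t2q orbT andbT; apply: contraNneq sNq => <-.
by exists s.1, b.
Qed.

(** A path with distinct vertices has distinct edges: the first edge contains the
    first vertex, which no later edge can meet. The last clause is stated for
    arbitrary neighbours [s] and [z] so that the closing edge can be put on
    either side. *)
Lemma path_trail G step A b q :
    (forall v f w, step v f w -> ends G f = [set v; w]) ->
    path (via step A) b q -> uniq (b :: q) ->
  exists p : seq (V * E),
    [/\ [seq s.1 | s <- p] = belast b q, uniq [seq s.2 | s <- p],
        all (fun s => (s.2 \in A) && [forall v in ends G s.2, v \in b :: q]) p
      & forall s z, step s.1 s.2 b -> z.1 = last b q ->
        path (fun s s' : V * E => step s.1 s.2 s'.1) s (rcons p z)].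
Proof.
move=> step_ends; elim: q b => [|c q IHq] b /=.
  by move=> _ _; exists [::]; split=> //= s z sb ->; rewrite sb.
case/andP=> /exists_inP[f fA bc] path_q /andP[bNq uniq_q].
have [p [p1 p2 pA pP]] := IHq c path_q uniq_q.
exists ((b, f) :: p); split=> /=; first by rewrite p1.
- rewrite p2 andbT; apply/mapP=> -[s sp fE].
  case/andP: (allP pA s sp) => _ /forall_inP/(_ b).
  by rewrite -fE (step_ends _ _ _ bc) set21 (negPf bNq) => /(_ isT).
- rewrite fA (step_ends _ _ _ bc); apply/andP; split.
    by apply/forall_inP=> v; rewrite !inE => /orP[]->; rewrite ?orbT.
  apply: sub_all pA => s /andP[-> /forall_inP sq].
  by apply/forall_inP=> v /sq; rewrite !inE => ->; rewrite orbT.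
- by move=> s z sb zE; rewrite sb; apply: pP.
Qed.

Lemma connect_circuit G step A e a b :
    (forall v f w, step v f w -> ends G f = [set v; w]) ->
    e \notin A -> step a e b -> connect (via step A) b a ->
  exists C, [/\ circuit step C, C \subset e |: A & e \in C].
Proof.
move=> step_ends eNA ab /connectP[q0 path_q0 aE].
move: aE; case/shortenP: path_q0 => q path_q uniq_q _ aE.
have [p [p1 p2 pA pP]] := path_trail step_ends path_q uniq_q.
have uniq_e : uniq [seq s.2 | s <- (a, e) :: p].
  rewrite /= p2 andbT; apply: contra eNA => /mapP[s sp ->].
  by case/andP: (allP pA s sp).
have size_p : (size ((a, e) :: p) <= #|E|)%N.
  by rewrite -(size_map snd) -(card_uniqP uniq_e) max_card.
exists [set f | f \in [seq s.2 | s <- (a, e) :: p]]; split.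
- apply/existsP; exists (Bseq size_p); apply/and5P; split=> //=.
    exact: pP.
  by rewrite p1 -rcons_uniq aE -lastI.
- apply/subsetP=> f; rewrite !inE => /orP[->//|/mapP[s sp ->]].
  by case/andP: (allP pA s sp) => ->; rewrite orbT.
- by rewrite !inE eqxx.
Qed.

End Circuits.

(** An arc is an edge with a direction, [true] standing for the direction of [D].
    An edge may contribute no, one or two arcs to a set of arcs. *)
Section Reach.
Variables (V E : finType) (D : digraph V E).
Implicit Types (a : E * bool) (s : {set E * bool}).

Definition asrc a := if a.2 then src D a.1 else tgt D a.1.
Definition atgt a := if a.2 then tgt D a.1 else src D a.1.

Definition traverse s : rel V :=
  fun v w => [exists a in s, (asrc a == v) && (atgt a == w)].
Definition reach s : rel V := connect (traverse s).

Lemma reach_refl s v : reach s v v.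
Proof. exact: connect0. Qed.

Lemma reach_trans s w v z : reach s v w -> reach s w z -> reach s v z.
Proof. exact: connect_trans. Qed.

Lemma reach_arc s a : a \in s -> reach s (asrc a) (atgt a).
Proof. by move=> sa; apply/connect1/exists_inP; exists a; rewrite ?eqxx. Qed.

Lemma reach_sub s s' v w : s \subset s' -> reach s v w -> reach s' v w.
Proof.
move=> /subsetP ss'; apply: connect_sub => {}v {}w /exists_inP[a /ss' sa].
by case/andP=> /eqP<- /eqP<-; apply: reach_arc.
Qed.

Lemma reach_sym s : (forall f d, ((f, d) \in s) = ((f, ~~ d) \in s)) ->
  forall v w, reach s v w = reach s w v.
Proof.
move=> sym_s; apply: sym_connect_sym => v w; apply/exists_inP/exists_inP;
  by case=> -[f d]; rewrite sym_s => sa vw; exists (f, ~~ d);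
     rewrite // andbC; case: (d) vw.
Qed.

Lemma reach_add s a v w :
  reach (a |: s) v w =
  reach s v w || reach s v (asrc a) && reach s (atgt a) w.
Proof.
apply/idP/idP; last first.
  have sub : s \subset a |: s by apply: subsetUr.
  case/orP=> [|/andP[va aw]]; first exact: reach_sub.
  apply: reach_trans (reach_sub sub va) _.
  apply: reach_trans (reach_sub sub aw).
  by apply: reach_arc; apply: setU11.
case/connectP=> p; elim: p v => [|z p IHp] v /=.
  by move=> _ ->; rewrite reach_refl.
case/andP=> /exists_inP[b]; rewrite in_setU1 => /predU1P[->|sb].
  case/andP=> /eqP<- /eqP<- {b} /IHp/[apply].
  by rewrite reach_refl => /orP[->|/andP[_ ->]]; rewrite orbT.
case/andP=> /eqP<- /eqP<- /IHp/[apply] /orP[bw|/andP[ba ->]].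
  by rewrite (reach_trans (reach_arc sb) bw).
by rewrite (reach_trans (reach_arc sb) ba) orbT.
Qed.

Lemma reach_closed s (S : {set V}) v w :
    (forall a, a \in s -> asrc a \in S -> atgt a \in S) ->
  reach s v w -> v \in S -> w \in S.
Proof.
move=> clS /connectP[p]; elim: p v => [|z p IHp] v /=; first by move=> _ ->.
case/andP=> /exists_inP[b sb /andP[/eqP<- /eqP<-]] /IHp/[apply] IH vS.
by apply: IH; apply: clS.
Qed.

End Reach.

(** * Replacing the largest oriented edge by its deletion and contraction *)

Section Weights.
Variables (V : finType) (disp : Order.disp_t) (E : finOrderType disp).
Variable D : digraph V E.
Implicit Types (a : E * bool) (s : {set E * bool}) (U A : {set E}).

Local Notation reach := (reach D).
Local Notation atgt := (atgt D).
Local Notation asrc := (asrc D).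

(** The smaller edges are contracted if [c], deleted otherwise; [e] itself is
    deleted. *)
Definition minor c s e : {set E * bool} :=
  [set a | if (a.1 < e)%O then c else (a.1 != e) && (a \in s)].

(** For an arc [a] of an orientation [s], this says for [c] false that the edge of
    [a] is smallest in a directed cycle, and for [c] true that it is not smallest
    in a directed cocycle. If the larger edges are all deleted or
    contracted, it says that the edge is a loop, respectively that it is not an
    isthmus, of the corresponding minor. *)
Definition closes c s a := reach (minor c s a.1) (atgt a) (asrc a).

(** Edges of [U] are contracted or deleted, the others are oriented. *)
Definition state U A : {set E * bool} :=
  [set a | if a.1 \in U then a.1 \in A else a.2 == (a.1 \notin A)].

Lemma minorS c c' s s' e : c ==> c' -> s \subset s' ->
  minor c s e \subset minor c' s' e.
Proof.
move=> /implyP cc' /subsetP ss'; apply/subsetP=> a; rewrite !inE.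
by case: ifP => // _ /andP[-> /ss'].
Qed.

Lemma closes_impl s a : closes false s a -> closes true s a.
Proof. by apply: reach_sub; apply: minorS. Qed.

Lemma minor_add c s w e :
  minor c (w |: s) e = if (e < w.1)%O then w |: minor c s e else minor c s e.
Proof.
case: ifPn => ew; apply/setP=> b; rewrite !inE; case: (b =P w) => [->|] //=.
  by rewrite ltNge (ltW ew) /= gt_eqF.
by case: (ltgtP w.1 e) ew.
Qed.

(** Unlike in [minor], the arcs of [e] are kept. This does not change whether the
    arc of an oriented edge closes up ([level_closes]), and it turns the family
    of arc sets into a chain. *)
Definition level c s e : {set E * bool} :=
  [set a | if (a.1 < e)%O then c else a \in s].

(** The levels with [c] false decrease with [e], those with [c] true increase, and
    [s] lies in between. *)
Lemma level_chain s c e c' e' :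
  level c s e \subset level c' s e' \/ level c' s e' \subset level c s e.
Proof.
wlog le_ee' : c e c' e' / (e <= e')%O.
  move=> IH; case: (leP e e') => [/(IH c _ c')|/ltW/(IH c' _ c)] //.
  by case=> h; [right | left].
have lt_e a : (a.1 < e)%O -> (a.1 < e')%O by move/lt_le_trans/(_ le_ee').
case: c' => [|]; case: c => [|]; [left | left | right | right];
  apply/subsetP=> a; rewrite !inE;
  by move: (lt_e a); case: (a.1 < e)%O; case: (a.1 < e')%O => // /(_ isT).
Qed.

Lemma minor_level c s e : minor c s e \subset level c s e.
Proof. by apply/subsetP=> a; rewrite !inE; case: ifP => // _ /andP[]. Qed.

(** A route from the target of an arc to its source gains nothing from using this
    arc. *)
Lemma level_closes c s a : (forall d, (a.1, d) \in s -> d = a.2) ->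
  reach (level c s a.1) (atgt a) (asrc a) -> closes c s a.
Proof.
move=> only_a /(@reach_sub _ _ _ _ (a |: minor c s a.1)).
rewrite reach_add /closes => /(_ _)/orP[|//|/andP[]//].
apply/subsetP=> -[f d]; rewrite !inE /=.
case: ifP => [_ ->|_]; first by rewrite orbT.
move=> sfd; case: (f =P a.1) sfd => [-> /only_a->|_ ->]; last by rewrite orbT.
by rewrite -surjective_pairing eqxx.
Qed.

(** The routes that close [a] and become available when [w] is added to [s]. *)
Definition through s w c a :=
  reach (minor c s a.1) (atgt a) (asrc w) &&
  reach (minor c s a.1) (atgt w) (asrc a).

Definition opp a : E * bool := (a.1, ~~ a.2).

Lemma asrc_opp a : asrc (opp a) = atgt a. Proof. by case: a => f []. Qed.
Lemma atgt_opp a : atgt (opp a) = asrc a. Proof. by case: a => f []. Qed.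

(** If adding [w] opened a new route for an arc [a], and adding [opp w] one for an
    arc [b], take the larger of the two levels, say that of [b]. In it one gets
    from the target of [b] to the source of [opp w], which is the target of [w],
    then to the source of [a], along [a], then to the source of [w], which is the
    target of [opp w], and to the source of [b]: this route was there before. *)
Lemma through_dichotomy s w (P : pred (E * bool)) :
    (forall a, P a -> a \in s /\ forall d, (a.1, d) \in s -> d = a.2) ->
  (forall c a, P a -> through s w c a -> closes c s a) \/
  (forall c a, P a -> through s (opp w) c a -> closes c s a).
Proof.
move=> Ps; pose bad v (ca : bool * (E * bool)) :=
  [&& P ca.2, through s v ca.1 ca.2 & ~~ closes ca.1 s ca.2].
have bad_ex v : (forall c a, P a -> through s v c a -> closes c s a) \/
    exists ca, bad v ca.
  case: (pickP (bad v)) => [ca ca_bad | no_bad]; first by right; exists ca.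
  left=> c a Pa va; move: (no_bad (c, a)); rewrite /bad /= Pa va /=.
  by move/negbFE.
case: (bad_ex w) => [|[[c a] /and3P[/= Pa /andP[aw wa] /negP Na]]]; first by left.
case: (bad_ex (opp w)) => [|[[c' b] /and3P[/= Pb /andP[bw wb] /negP Nb]]].
  by right.
have [[sa oa] [sb ob]] := (Ps a Pa, Ps b Pb).
have L c0 e v z : reach (minor c0 s e) v z -> reach (level c0 s e) v z.
  exact: reach_sub (minor_level _ _ _).
have in_level c0 d : d \in s -> d \in level c0 s d.1 by rewrite inE ltxx.
rewrite asrc_opp in bw; rewrite atgt_opp in wb.
case: (level_chain s c a.1 c' b.1) => sub; exfalso; [apply: Nb | apply: Na];
  apply: level_closes => //.
- have K v z := fun h => reach_sub sub (L c a.1 v z h).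
  apply: reach_trans (L _ _ _ _ bw) _; apply: reach_trans (K _ _ wa) _.
  apply: reach_trans (reach_arc _ (subsetP sub _ (in_level c _ sa))) _.
  by apply: reach_trans (K _ _ aw) _; apply: L.
- have K v z := fun h => reach_sub sub (L c' b.1 v z h).
  apply: reach_trans (L _ _ _ _ aw) _; apply: reach_trans (K _ _ wb) _.
  apply: reach_trans (reach_arc _ (subsetP sub _ (in_level c' _ sb))) _.
  by apply: reach_trans (K _ _ bw) _; apply: L.
Qed.

Lemma closes_far c s w a : (w.1 <= a.1)%O -> closes c (w |: s) a = closes c s a.
Proof. by move=> wa; rewrite /closes minor_add ltNge wa. Qed.

Lemma closes_add c s w a : (a.1 < w.1)%O ->
  closes c (w |: s) a = closes c s a || through s w c a.
Proof. by move=> aw; rewrite /closes minor_add aw reach_add. Qed.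

(** A route that uses both directions of an edge can be cut short, so contracting
    an edge only opens the routes through one of its directions. *)
Lemma closes_add2 c s w a : (a.1 < w.1)%O ->
  closes c (w |: (opp w |: s)) a =
  [|| closes c s a, through s w c a | through s (opp w) c a].
Proof.
move=> aw; rewrite !closes_add // /through minor_add aw !reach_add /closes.
rewrite !asrc_opp !atgt_opp !reach_refl andbT /=.
set m := minor c s a.1.
have := @reach_trans _ _ D m (asrc w) (atgt a) (asrc a).
have := @reach_trans _ _ D m (atgt w) (atgt a) (asrc a).
case: (reach m (atgt a) (asrc a)) => //.
case: (reach m (atgt a) (atgt w)) => //; case: (reach m (atgt a) (asrc w)) => //;
case: (reach m (atgt w) (asrc a)) => //; case: (reach m (asrc w) (asrc a)) => //;
  by move=> H H'; first [have := H isT isT | have := H' isT isT].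
Qed.

(** The edge [w] is the largest one outside [U], so that [U] consists of the edges
    above [w]; in [s0] it is deleted. *)
Section Step.
Variables (w : E) (U A : {set E}).
Hypotheses (UE : forall f, (f \in U) = (w < f)%O) (wNA : w \notin A).
Let s0 := state (w |: U) A.

Lemma state_forward : state U A = (w, true) |: s0.
Proof.
apply/setP=> -[f d]; rewrite !inE /= UE -pair_eqE /pair_eq /=.
by case: (f =P w) => [->|_] //=; rewrite ltxx wNA; case: d; rewrite ?(negPf wNA).
Qed.

Lemma state_backward : state U (w |: A) = (w, false) |: s0.
Proof.
apply/setP=> -[f d]; rewrite !inE /= UE -pair_eqE /pair_eq /=.
by case: (f =P w) => [->|_] //=; rewrite ltxx (negPf wNA) orbF; case: d.
Qed.

Lemma state_contract :
  state (w |: U) (w |: A) = (w, true) |: ((w, false) |: s0).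
Proof.
apply/setP=> -[f d]; rewrite !inE /= UE -!pair_eqE /pair_eq /=.
by case: (f =P w) => [->|_] //=; case: d.
Qed.

Definition below : pred (E * bool) := fun a => (a.1 < w)%O && (a \in s0).

Lemma below_oriented a : below a ->
  a \in s0 /\ forall d, (a.1, d) \in s0 -> d = a.2.
Proof.
case/andP=> aw sa; split=> // d; move: sa.
by rewrite !inE UE (lt_eqF aw) ltNge (ltW aw) /= => /eqP-> /eqP.
Qed.

Lemma minor_top_sym c v z :
  reach (minor c s0 w) v z = reach (minor c s0 w) z v.
Proof.
by apply: reach_sym => f d; rewrite !inE /= UE; case: ltgtP.
Qed.

Lemma closes_opp_top c d : closes c s0 (w, d) = closes c s0 (w, true).
Proof. by case: d => //; rewrite /closes /= minor_top_sym. Qed.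

(** If [w] is a loop, a route through [w] can use the larger edges instead, and
    these are kept in the minor of every smaller edge. *)
Lemma through_loop c d a : closes false s0 (w, true) ->
  below a -> through s0 (w, d) c a -> closes c s0 a.
Proof.
rewrite -(closes_opp_top _ (~~ d)) => loop_w /andP[aw _] /andP[t1 t2].
apply: reach_trans t1 _; apply: reach_trans t2.
have: closes false s0 (opp (w, d)) by [].
rewrite /closes atgt_opp asrc_opp; apply: reach_sub.
apply/subsetP=> b; rewrite !inE; case: ltgtP => //= bw.
by rewrite ltNge (ltW (lt_trans aw bw)) /= (gt_eqF (lt_trans aw bw)).
Qed.

(** If [w] is an isthmus, no route can close by crossing it once: the smaller edge
    of [a], contracted in the minor at [w], would connect the ends of [w]. *)
Lemma through_isthmus c d a : ~~ closes true s0 (w, true) ->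
  below a -> through s0 (w, d) c a -> closes c s0 a.
Proof.
rewrite -(closes_opp_top _ d) => /negP isthmus_w /andP[aw _] /andP[t1 t2].
case: isthmus_w; have sub : minor c s0 a.1 \subset minor true s0 w.
  apply/subsetP=> b; rewrite !inE; case: ltgtP => //= [ba _|ab].
    by rewrite (lt_trans ba aw).
  by case: ltgtP => //= ->; rewrite (negPf wNA).
apply: reach_trans (reach_sub sub t2) _; apply: reach_trans (reach_sub sub t1).
by apply: reach_arc; rewrite inE aw.
Qed.

End Step.

Section Weight.
Variables (R : comNzRingType) (x u y v : R).

Definition act_weight (ext int : R) (in_cycle no_cocycle : bool) :=
  if in_cycle then ext else if no_cocycle then 1 else int.

(** The weights 0 kill the states in which a loop is contracted or an isthmus
    deleted; when [U] contains all edges, only the spanning trees survive. The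
    direction given to an edge of [U] is immaterial when [U] is up-closed. *)
Definition weight U A e : R :=
  let a := (e, (e \in U) || (e \notin A)) in
  let s := state U A in
  (if e \in U then
     if e \in A then act_weight 0 (x + u) else act_weight (y + v) 0
   else if e \in A then act_weight v u else act_weight y x)
    (closes false s a) (closes true s a).

Definition total_weight U A := \prod_e weight U A e.

Lemma weight_eq U U' A A' e : (e \in U) = (e \in U') -> (e \in A) = (e \in A') ->
    (forall c d, d = (e \in U) || (e \notin A) ->
       closes c (state U A) (e, d) = closes c (state U' A') (e, d)) ->
  weight U A e = weight U' A' e.
Proof. by rewrite /weight => <- <- H; rewrite !H. Qed.

(** The left hand side sums over the two orientations of [w], the right hand side
    over its deletion and its contraction. *)
Lemma weight_step w U A : (forall f, (f \in U) = (w < f)%O) -> w \notin A ->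
  total_weight U A + total_weight U (w |: A) =
  total_weight (w |: U) A + total_weight (w |: U) (w |: A).
Proof.
move=> UE wNA; set s0 := state (w |: U) A.
have sF := state_forward UE wNA; have sB := state_backward UE wNA.
have sC := state_contract A UE; rewrite -/s0 in sF sB sC.
pose good d := forall c a, below w U A a -> through s0 (w, d) c a -> closes c s0 a.
have eqU e : e != w -> (e \in w |: U) = (e \in U) by rewrite in_setU1 => /negPf->.
have eqA e : e != w -> (e \in w |: A) = (e \in A) by rewrite in_setU1 => /negPf->.
have lowP e d : (e < w)%O -> d = (e \in U) || (e \notin A) -> below w U A (e, d).
  move=> ew ->; rewrite /below /= ew inE /= !inE UE (lt_eqF ew) ltNge (ltW ew) /=.
  exact: eqxx.
(* A direction of w that opens no new route acts as deletion on the other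
   edges; its opposite then acts as contraction. *)
have F_del : good true -> forall e, e != w ->
    weight U A e = weight (w |: U) A e.
  move=> gd e ew; apply: weight_eq; rewrite ?eqU // => c d dE; rewrite sF.
  case: (ltgtP e w) ew => // [ew|we] _; last by rewrite closes_far ?ltW.
  rewrite closes_add //; apply/orb_idr/gd; exact: lowP.
have B_del : good false -> forall e, e != w ->
    weight U (w |: A) e = weight (w |: U) A e.
  move=> gd e ew; apply: weight_eq; rewrite ?eqU ?eqA // => c d dE; rewrite sB.
  case: (ltgtP e w) ew => // [ew|we] _; last by rewrite closes_far ?ltW.
  rewrite closes_add //; apply/orb_idr/gd; exact: lowP.
have B_con : good true -> forall e, e != w ->
    weight U (w |: A) e = weight (w |: U) (w |: A) e.
  move=> gd e ew; apply: weight_eq; rewrite ?eqU ?eqA // => c d dE; rewrite sB sC.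
  case: (ltgtP e w) ew => // [ew|we] _; last by rewrite !closes_far ?ltW.
  rewrite closes_add // closes_add2 //.
  case: (closes c s0 _) (gd c (e, d) (lowP _ _ ew dE)) => //=.
  by case: (through _ (w, true) _ _) => [/(_ isT)|].
have F_con : good false -> forall e, e != w ->
    weight U A e = weight (w |: U) (w |: A) e.
  move=> gd e ew; apply: weight_eq; rewrite ?eqU ?eqA // => c d dE; rewrite sF sC.
  case: (ltgtP e w) ew => // [ew|we] _; last by rewrite !closes_far ?ltW.
  rewrite closes_add // closes_add2 //.
  case: (closes c s0 _) (gd c (e, d) (lowP _ _ ew dE)) => //=.
  rewrite /opp /=; case: (through _ (w, false) _ _) => [/(_ isT)//|_].
  by rewrite orbF.
have top c d W : W = s0 \/ W = (w, true) |: s0 \/ W = (w, false) |: s0 \/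
    W = (w, true) |: ((w, false) |: s0) ->
  closes c W (w, d) = closes c s0 (w, true).
  rewrite -(closes_opp_top _ UE c d).
  by case=> [|[|[]]] ->; rewrite ?closes_far.
have split_w U' A' :
    total_weight U' A' = weight U' A' w * \prod_(e | e != w) weight U' A' e.
  exact: bigD1.
pose cy := closes false s0 (w, true); pose nc := closes true s0 (w, true).
have wF : weight U A w = act_weight y x cy nc.
  by rewrite /weight UE ltxx (negPf wNA) /= !top; auto.
have wB : weight U (w |: A) w = act_weight v u cy nc.
  by rewrite /weight UE ltxx setU11 /= !top; auto.
have wD : weight (w |: U) A w = act_weight (y + v) 0 cy nc.
  by rewrite /weight setU11 (negPf wNA) /= !top; auto.
have wC : weight (w |: U) (w |: A) w = act_weight 0 (x + u) cy nc.
  by rewrite /weight !setU11 /= !top; auto.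
rewrite !split_w wF wB wD wC {split_w wF wB wD wC top} /cy /nc {cy nc}.
have both_good :
    good true -> good false -> forall a b c d : R, a + b = c + d ->
    a * \prod_(e | e != w) weight U A e +
    b * \prod_(e | e != w) weight U (w |: A) e =
    c * \prod_(e | e != w) weight (w |: U) A e +
    d * \prod_(e | e != w) weight (w |: U) (w |: A) e.
  move=> gt gf a b c d abcd.
  rewrite (eq_bigr _ (F_del gt)) (eq_bigr _ (B_del gf)).
  rewrite -(eq_bigr _ (B_con gt)) (eq_bigr _ (B_del gf)).
  by rewrite -!mulrDl abcd.
case: (boolP (closes false s0 (w, true))) => [loop_w|_].
  by apply: both_good => [c a|c a|]; [exact: through_loop.. | rewrite /=; ring].
case: (boolP (closes true s0 (w, true))) => [_|isthmus_w]; last first.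
  by apply: both_good => [c a|c a|]; [exact: through_isthmus.. | rewrite /=; ring].
rewrite /= !mul1r.
have [|gt|gf] := through_dichotomy (w, true) (P := below w U A) (s := s0).
- exact: below_oriented.
- by rewrite (eq_bigr _ (F_del gt)) (eq_bigr _ (B_con gt)).
- by rewrite (eq_bigr _ (F_con gf)) (eq_bigr _ (B_del gf)) addrC.
Qed.

Lemma total_weight_step w U : (forall f, (f \in U) = (w < f)%O) ->
  \sum_A total_weight U A = \sum_A total_weight (w |: U) A.
Proof.
move=> UE; have pairs F : \sum_(A : {set E}) F A =
    \sum_(A : {set E} | w \notin A) (F A + F (w |: A)) :> R.
  rewrite (bigID (fun A : {set E} => w \notin A)) big_split /=; congr (_ + _).
  rewrite (reindex_onto (fun A => w |: A) (fun A => A :\ w)) /=.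
    apply: eq_bigl => A; rewrite setU11 /=.
    by apply/eqP/idP => [<-|wA]; rewrite ?setD11 // setU1K.
  by move=> A; rewrite negbK => wA; rewrite setD1K.
by rewrite !pairs; apply: eq_bigr => A wNA; apply: weight_step.
Qed.

Lemma total_weight_transfer :
  \sum_A total_weight set0 A = \sum_A total_weight setT A.
Proof.
suff transfer n U : #|~: U| = n ->
    (forall e f, e \in U -> (e <= f)%O -> f \in U) ->
    \sum_A total_weight U A = \sum_A total_weight setT A.
  by apply: (transfer #|~: set0|) => // e f; rewrite inE.
elim: n U => [|n IHn] U cardU upU.
  by congr (\sum_A total_weight _ A); rewrite -[U]setCK (cards0_eq cardU) setC0.
have [w0 w0U] : exists w0, w0 \in ~: U by apply/set0Pn; rewrite -card_gt0 cardU.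
case: (Order.TotalTheory.arg_maxP (P := mem (~: U)) id w0U) => w wNU max_w.
have wU : w \notin U by rewrite -in_setC.
have UE f : (f \in U) = (w < f)%O.
  apply/idP/idP => [fU|wf].
    by rewrite ltNge; apply: contra wU => fw; apply: upU fw.
  apply: contraTT wf => fNU; rewrite -leNgt.
    by apply: (max_w f); have : f \in ~: U by rewrite inE.
rewrite (total_weight_step UE); apply: IHn.
  move: cardU; rewrite (cardsD1 w) inE wU => -[<-].
  by apply: eq_card => f; rewrite !inE negb_or.
move=> e f; rewrite !inE !UE => /predU1P[->|we]; first by rewrite le_eqVlt eq_sym.
by move=> ef; rewrite (lt_le_trans we ef) orbT.
Qed.

End Weight.
End Weights.

(** * Cuts and directed cocycles *)

Section Cuts.
Variables (V E : finType).
Implicit Types (G : mgraph V E) (D : digraph V E) (S : {set V}) (B : {set E}).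

Lemma ends_cut G S f v w : ends G f = [set v; w] ->
  (f \in cut G S) = (v \in S) (+) (w \in S).
Proof.
by rewrite inE => ->; rewrite !subUset !sub1set !inE; do 2!case: (_ \in S).
Qed.

Lemma adjacent_ends G B f v w : f \in B -> ends G f = [set v; w] ->
  adjacent G B v w.
Proof. by move=> fB fE; apply/exists_inP; exists f; rewrite ?fE. Qed.

Lemma adjacent_sub G B B' v w : B \subset B' ->
  connect (adjacent G B) v w -> connect (adjacent G B') v w.
Proof.
move=> /subsetP sub; apply: connect_sub => {}v {}w /exists_inP[f /sub fB /eqP fE].
exact/connect1/(adjacent_ends fB).
Qed.

Lemma adjacent_connect_sym G B : connect_sym (adjacent G B).
Proof.
by apply: sym_connect_sym => v w; apply: eq_existsb => f; rewrite setUC.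
Qed.

Lemma adjacent_side G B S v w : (forall f, f \in B -> f \notin cut G S) ->
  connect (adjacent G B) v w -> (v \in S) = (w \in S).
Proof.
move=> BS; apply: closed_connect => {}v {}w /exists_inP[f /BS + /eqP fE].
by rewrite (ends_cut _ fE); do 2!case: (_ \in S).
Qed.

Lemma set2_inj (a b v w : V) : [set a; b] = [set v; w] ->
  a = v /\ b = w \/ a = w /\ b = v.
Proof.
move=> eq_ab.
have: a \in [set v; w] by rewrite -eq_ab set21.
have: b \in [set v; w] by rewrite -eq_ab set22.
have: v \in [set a; b] by rewrite eq_ab set21.
have: w \in [set a; b] by rewrite eq_ab set22.
by rewrite !inE; do 4![case/orP=> /eqP ?]; subst; auto.
Qed.

Lemma connect_ends G B a b v w : [set a; b] = [set v; w] ->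
  connect (adjacent G B) a b = connect (adjacent G B) v w.
Proof.
by move/set2_inj=> [[-> ->]|[-> ->]] //; rewrite adjacent_connect_sym.
Qed.

Lemma underlying_cut D S f :
  (f \in cut (underlying D) S) = (src D f \in S) (+) (tgt D f \in S).
Proof. exact: ends_cut. Qed.

(** Take for [C] a minimal directed cut that contains [e] and lies in [cut S], say
    [C = cut T] with all edges leaving [T]. Let [cut R] be a nonempty cut inside
    [C], with the source of [e] in [R]. No edge of [cut R] lies inside [T] or
    inside its complement, so [cut (T :&: R)] is a directed cut in [C]; it contains
    [e], hence it is [C], and all edges of [C] start in [R]. Similarly, for the
    one of [R] and [~: R] that misses the target of [e], its union with [T] shows
    that the targets of all edges of [C] are on the same side of [R]. This is not
    the side of their sources, since [cut R] is not empty; so [cut R] is [C]. *)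
Lemma directed_cocycle_sub D S e :
    (forall f, f \in cut (underlying D) S ->
       (src D f \in S) && (tgt D f \notin S)) ->
    e \in cut (underlying D) S ->
  exists C, [/\ directed_cocycle D C, C \subset cut (underlying D) S & e \in C].
Proof.
move=> dirS eS; pose K := cut (underlying D).
pose P (B : {set E}) := [exists S, [&& B == K S, e \in B
   & [forall f in B, (src D f \in S) && (tgt D f \notin S)]]].
have PS : P (K S).
  by apply/existsP; exists S; rewrite eqxx eS /=; apply/forall_inP.
have [C /minsetP[PC minC] CS] := minset_exists PS.
case/existsP: PC => T /and3P[/eqP CT eC /forall_inP dirC].
exists C; split=> //; rewrite /directed_cocycle; apply/andP; split; last first.
  by apply/existsP; exists T; rewrite -/K -CT eqxx; apply/forall_inP.
apply/minsetP; split.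
  apply/andP; split; first by apply/set0Pn; exists e.
  by apply/existsP; exists T; apply/eqP.
move=> B /andP[Bn0 /existsP[R0 /eqP BR0]] BC.
pose R := if src D e \in R0 then R0 else ~: R0.
have BR f : (f \in B) = (src D f \in R) (+) (tgt D f \in R).
  rewrite BR0 underlying_cut /R; case: ifP => // _; rewrite !inE.
  by do 2!case: (_ \in R0).
have eR : src D e \in R by rewrite /R; case: ifP => // /negbT; rewrite inE.
have CE f : (f \in C) = (src D f \in T) && (tgt D f \notin T).
  apply/idP/idP => [/dirC //|]; rewrite CT underlying_cut.
  by case/andP=> -> /negPf->.
have sepT f : (src D f \in T) (+) (tgt D f \in T) ==>
    (src D f \in T) && (tgt D f \notin T).
  by apply/implyP; rewrite -CE CT underlying_cut.
have sepR f : (src D f \in R) (+) (tgt D f \in R) ==>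
    (src D f \in T) && (tgt D f \notin T).
  by apply/implyP; rewrite -CE -BR; apply: (subsetP BC).
have [eT e'T] : src D e \in T /\ tgt D e \notin T by apply/andP; rewrite -CE.
have minK (X : {set V}) : src D e \in X -> tgt D e \notin X ->
    (forall f, (src D f \in X) (+) (tgt D f \in X) ->
       [&& f \in C, src D f \in X & tgt D f \notin X]) ->
    forall f, f \in C -> (src D f \in X) && (tgt D f \notin X).
  move=> eX e'X dirX f; rewrite -(minC (K X)).
  - by rewrite underlying_cut => /dirX/and3P[_ -> ->].
  - apply/existsP; exists X; rewrite eqxx underlying_cut eX (negPf e'X) /=.
    by apply/forall_inP=> g; rewrite underlying_cut => /dirX/and3P[_ -> ->].
  - by apply/subsetP=> g; rewrite underlying_cut => /dirX/and3P[].
have srcR f : f \in C -> src D f \in R.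
  move=> fC; suff /andP[] : (src D f \in T :&: R) && (tgt D f \notin T :&: R).
    by case/setIP.
  move: f fC; apply: minK => [||g]; rewrite ?inE ?eT ?(negPf e'T) //.
  by move: (sepT g) (sepR g); rewrite CE; do 4!case: (_ \in _).
pose R' := if tgt D e \in R then ~: R else R.
have tgtR' f : f \in C -> tgt D f \notin R'.
  move=> fC; suff /andP[_] : (src D f \in T :|: R') && (tgt D f \notin T :|: R').
    by rewrite inE negb_or => /andP[].
  move: f fC; apply: minK => [||g].
  - by rewrite inE eT.
  - by rewrite inE (negPf e'T) /R'; case: ifPn; rewrite // inE negbK.
  - move: (sepT g) (sepR g); rewrite CE /R'; case: ifP => _;
    by rewrite !inE; do 4!case: (_ \in _).
apply/eqP; rewrite eqEsubset BC /=; apply/subsetP => f fC.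
rewrite BR srcR //; move: (tgtR' f fC); rewrite /R'; case: ifPn => // e'R _.
case/set0Pn: Bn0 => g gB; have gC := subsetP BC g gB.
move: gB (tgtR' g gC); rewrite BR srcR // /R' e'R inE negbK.
by case: (_ \in R).
Qed.

End Cuts.

(** * Smallest edges of directed cycles and cocycles *)

Section Orientations.
Variables (V : finType) (disp : Order.disp_t) (E : finOrderType disp).
Implicit Types (D : digraph V E) (A : {set E}).

Lemma mem_minor_forward c (f : E) d (e : E) :
  ((f, d) \in minor c (state set0 set0) e) = if (f < e)%O then c else (f != e) && d.
Proof. by rewrite !inE /=; case: ifP => //; case: d. Qed.

Lemma closes_reorient D A c e :
  closes (reorient A D) c (state set0 set0) (e, true) =
  closes D c (state set0 A) (e, e \notin A).
Proof.
rewrite /closes /reach.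
have <- : atgt (reorient A D) (e, true) = atgt D (e, e \notin A).
  by rewrite /atgt /=; case: (e \in A).
have <- : asrc (reorient A D) (e, true) = asrc D (e, e \notin A).
  by rewrite /asrc /=; case: (e \in A).
apply: eq_connect => v w /=.
apply/exists_inP/exists_inP=> -[[f d] fd fE]; exists (f, d (+) (f \in A)).
- move: fd; rewrite !inE /=; case: ifP => // _.
  by case: d {fE} => // /andP[->]; rewrite ?eqxx.
- move: fE; rewrite /asrc /atgt /=; case: (f \in A); case: d {fd} => //=.
- by move: fd; rewrite !inE /=; case: ifP => // _; case: d {fE}; case: (f \in A).
- move: fE; rewrite /asrc /atgt /=; case: (f \in A); case: d {fd} => //=.
Qed.

Lemma mem_Oset D e : (e \in Oset D) = closes D false (state set0 set0) (e, true).
Proof.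
pose step v f w := (src D f == v) && (tgt D f == w).
have step_ends v f w : step v f w -> ends (underlying D) f = [set v; w].
  by case/andP=> /eqP<- /eqP<-.
have arcE v w : traverse D (minor false (state set0 set0) e) v w =
    via step [set f | e < f]%O v w.
  apply/exists_inP/exists_inP=> [[[f d]]|[f]].
    rewrite mem_minor_forward; case: ltgtP => //= ef.
    by case: d => // _; exists f; rewrite ?inE.
  rewrite inE => ef vfw; exists (f, true) => //.
  by rewrite mem_minor_forward; case: ltgtP ef.
rewrite /closes /reach (eq_connect arcE) /asrc /atgt /= inE.
apply/existsP/idP => [[C /andP[cycC /andP[eC /forall_inP minC]]]|].
  have [a [b [/andP[/eqP-> /eqP->]]]] := circuit_connect cycC eC.
  apply: connect_sub => v w /exists_inP[f]; rewrite !inE => /andP[fe /minC ef] vfw.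
  by apply/connect1/exists_inP; exists f; rewrite // inE lt_neqAle eq_sym fe.
move=> /(connect_circuit step_ends (e := e))[||C [cycC CS eC]].
- by rewrite inE ltxx.
- by rewrite /step !eqxx.
- exists C; rewrite /directed_cycle cycC /smallest eC /=.
  by apply/forall_inP=> f /(subsetP CS); rewrite !inE => /predU1P[->//|/ltW].
Qed.

(** A directed cocycle with smallest edge [e] cannot be entered from the side of the
    target of [e]: smaller edges do not cross it and larger ones cross it in one
    direction only. Conversely the vertices that the target of [e] does not reach
    define a directed cut, which contains a directed cocycle through [e]. *)
Lemma mem_Oset_dual D e :
  (e \in Oset_dual D) = ~~ closes D true (state set0 set0) (e, true).
Proof.
rewrite inE /closes; set m := minor true _ e; rewrite /atgt /asrc /=.
apply/existsP/idP => [[C /andP[/andP[_ /existsP[S /andP[/eqP-> dirS]]]]]|].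
  case/andP=> eS /forall_inP minS; apply/negP => te.
  have /andP[eSS e'NS] := forall_inP dirS e eS.
  suff: src D e \in ~: S by rewrite inE eSS.
  apply: reach_closed te _; last by rewrite inE.
  move=> [f d]; rewrite mem_minor_forward; rewrite !inE.
  case: ltgtP => [fe _|ef /= d1|//].
    have: f \notin cut (underlying D) S.
      by apply: contraL fe => /minS; rewrite leNgt.
    by rewrite underlying_cut /asrc /atgt /=; case: d; do 2!case: (_ \in S).
  rewrite /asrc /atgt d1 /=; case: (boolP (f \in cut (underlying D) S)).
    by move/(forall_inP dirS)/andP=> [-> ].
  by rewrite underlying_cut; do 2!case: (_ \in S).
move=> nte; pose S := [set v | ~~ reach D m (tgt D e) v].
have eS : e \in cut (underlying D) S.
  by rewrite underlying_cut !inE reach_refl nte.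
have minS f : f \in cut (underlying D) S ->
    [&& (e <= f)%O, src D f \in S & tgt D f \notin S].
  have stepS d : (f, d) \in m -> asrc D (f, d) \notin S -> atgt D (f, d) \notin S.
    move=> fm; rewrite !inE !negbK => te; apply: reach_trans te _.
    exact: reach_arc.
  rewrite underlying_cut; case: (ltgtP f e) => [fe|ef|->] /=.
  - have := stepS true; have := stepS false; rewrite !mem_minor_forward fe.
    by rewrite /asrc /atgt /=; do 2!case: (_ \in S) => //=;
       move=> // H H'; first [have := H isT isT | have := H' isT isT].
  - have := stepS true; rewrite !mem_minor_forward /= (gt_eqF ef) ltNge (ltW ef) /=.
    by rewrite /asrc /atgt /=; do 2!case: (_ \in S) => //=; move=> // /(_ isT isT).
  - by rewrite !inE reach_refl nte.
have [|C [dirC CS eC]] := @directed_cocycle_sub _ _ D S e _ eS.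
  by move=> f /minS/and3P[_ -> ->].
exists C; rewrite dirC /smallest eC; apply/forall_inP => f /(subsetP CS)/minS.
by case/andP.
Qed.

End Orientations.

(** * Activities of spanning trees *)

Section SpanningTrees.
Variables (V : finType) (disp : Order.disp_t) (E : finOrderType disp).
Variables (G : mgraph V E) (D : digraph V E).
Hypothesis orientD : orientation G D.
Implicit Types (A B C T : {set E}).

(** [minor], for states in which all edges are deleted or contracted. *)
Definition tree_minor c T (e : E) : {set E} :=
  [set f | if (f < e)%O then c else (f != e) && (f \in T)].

Local Notation linked B e := (connect (adjacent G B) (tgt D e) (src D e)).

Lemma closes_tree c T e :
  closes D c (state setT T) (e, true) = linked (tree_minor c T e) e.
Proof.
rewrite /closes /reach /atgt /asrc /=; apply: eq_connect => v w.
have mem_f f d : ((f, d) \in minor c (state setT T) e) = (f \in tree_minor c T e).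
  by rewrite !inE.
apply/exists_inP/exists_inP=> [[[f d]]|[f fT]].
  rewrite mem_f => fT /andP[/eqP<- /eqP<-]; exists f => //; rewrite orientD.
  by rewrite /asrc /atgt; case: d => //=; rewrite setUC.
rewrite orientD => /eqP/set2_inj[[<- <-]|[<- <-]].
  by exists (f, true); rewrite ?mem_f /asrc /atgt ?eqxx.
by exists (f, false); rewrite ?mem_f /asrc /atgt ?eqxx.
Qed.

Lemma mem_cut S f : (f \in cut G S) = (src D f \in S) (+) (tgt D f \in S).
Proof. exact: ends_cut. Qed.

Lemma component_cut B s f :
  f \in B -> f \notin cut G [set z | connect (adjacent G B) s z].
Proof.
move=> fB; rewrite mem_cut !inE.
have st : connect (adjacent G B) (src D f) (tgt D f).
  exact/connect1/(adjacent_ends fB).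
by rewrite (same_connect_r (adjacent_connect_sym _ _) st) addbb.
Qed.

Lemma gcycle_linked C e : gcycle G C -> e \in C -> linked (C :\ e) e.
Proof.
move=> cycC eC; have [a [b [/eqP eE]]] := circuit_connect cycC eC.
by rewrite (@connect_ends _ _ G _ _ _ b a) // setUC -orientD eE setUC.
Qed.

Lemma linked_gcycle A e : e \notin A -> linked A e ->
  exists C, [/\ gcycle G C, C \subset e |: A & e \in C].
Proof.
move=> eNA.
apply: (@connect_circuit _ _ G (fun v f w => ends G f == [set v; w])) eNA _.
  by move=> v f w /eqP.
by rewrite orientD.
Qed.

Lemma tree_minor0 T e f : (f \in tree_minor false T e) = (e < f)%O && (f \in T).
Proof. by rewrite inE; case: ltgtP. Qed.

Lemma tree_minorNe c T e : e \notin tree_minor c T e.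
Proof. by rewrite inE ltxx eqxx. Qed.

Lemma acyclic T C : spanning_tree G T -> C \subset T -> gcycle G C = false.
Proof. by case/andP=> _ /forallP/(_ C)/implyP H /H/negPf. Qed.

Lemma tree_connected T v w : spanning_tree G T -> connect (adjacent G T) v w.
Proof. by case/andP=> /forallP/(_ v)/forallP/(_ w). Qed.

Lemma tree_unlinked T A e : spanning_tree G T -> e \in T -> A \subset T :\ e ->
  linked A e = false.
Proof.
move=> treeT eT /subsetD1P[AT eNA].
apply/negP => /(linked_gcycle eNA)[C [cycC CA _]].
rewrite (acyclic treeT) // in cycC; apply: subset_trans CA _.
by rewrite subUset sub1set eT.
Qed.

(** If larger edges of [T] join the ends of [e], they replace [e] in the
    fundamental cycle [C] of [e]; so an edge [f < e] of [C] would have its ends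
    joined in [T :\ f], and [T] would contain a cycle. *)
Lemma ext_activeE T e : spanning_tree G T -> e \notin T ->
  smallest (fund_cycle G T e) e = linked (tree_minor false T e) e.
Proof.
move=> treeT eT; rewrite /fund_cycle.
case: pickP => [C /andP[cycC CT]|noC] /=; last first.
  rewrite /smallest inE; apply/esym/negP.
  move=> /(linked_gcycle (tree_minorNe _ _ _))[C [cycC CN _]].
  have:= noC C; rewrite cycC /=; move/negP; case; apply: subset_trans CN _.
  by apply/setUS/subsetP=> f; rewrite tree_minor0 => /andP[].
have eC : e \in C.
  apply: contraT => eC; rewrite (@acyclic T C) // in cycC.
  apply/subsetP=> f fC; move: (subsetP CT f fC); rewrite !inE => /predU1P[fe|//].
  by rewrite -fe fC in eC.
rewrite /smallest eC /=; apply/forall_inP/idP => [minC|eN f fC].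
  apply: adjacent_sub (gcycle_linked cycC eC); apply/subsetP=> f.
  rewrite tree_minor0 !inE => /andP[fe fC].
  rewrite lt_neqAle eq_sym fe minC //=.
  by move: (subsetP CT f fC); rewrite !inE (negPf fe).
rewrite leNgt; apply/negP => fe.
have fT : f \in T by move: (subsetP CT f fC); rewrite !inE (lt_eqF fe).
have := tree_unlinked treeT fT (subxx _); case/negP.
apply: connect_sub (gcycle_linked cycC fC) => v w /exists_inP[g].
rewrite !inE => /andP[gf gC] /eqP gE.
case: (g =P e) => [ge|/eqP ge].
  rewrite (connect_ends G _ (v := tgt D e) (w := src D e)); last first.
    by rewrite -gE ge orientD setUC.
  apply: adjacent_sub eN; apply/subsetP=> h.
  by rewrite tree_minor0 !inE => /andP[eh ->]; rewrite (gt_eqF (lt_trans fe eh)).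
apply/connect1/(adjacent_ends _ gE); rewrite !inE gf.
by move: (subsetP CT g gC); rewrite !inE (negPf ge).
Qed.

(** Let [S] be the component of an end of [b] when the other edges of [T] above [b]
    and all edges below [b] are kept. If the ends of [b] are separated, then [b]
    is the only edge of [T] in [cut S], and likewise in the fundamental cocycle
    [cut S']. So no edge of [T] crosses the symmetric difference of [S] and [S'],
    which therefore is empty or everything: the two cuts agree, and [cut S] has
    no edge below [b]. *)
Lemma int_activeE T b : spanning_tree G T -> b \in T ->
  smallest (fund_cocycle G T b) b = ~~ linked (tree_minor true T b) b.
Proof.
move=> treeT bT; pose N := tree_minor true T b; rewrite -/N.
pose S := [set v | connect (adjacent G N) (tgt D b) v].
have NS f : f \in N -> f \notin cut G S by apply: component_cut.
have bS : ~~ linked N b -> b \in cut G S.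
  by rewrite mem_cut !inE connect0 => /negPf->.
have cutS_T f : f \in T -> f != b -> f \notin cut G S.
  by move=> fT fb; apply: NS; rewrite inE fb fT; case: ifP.
rewrite /fund_cocycle; case: pickP => [C /andP[cocC CT]|noC] /=; last first.
  rewrite /smallest inE; apply/esym/negbF; apply: contraT => /bS {}bS.
  have [|C cocC CS] := @minset_exists _
    (fun B : {set E} => (B != set0) && [exists S, B == cut G S]) (cut G S).
    apply/andP; split; first by apply/set0Pn; exists b.
    by apply/existsP; exists S.
  have := noC C; rewrite /cocycle cocC /=; move/negP; case.
  apply: subset_trans CS _; apply/subsetP=> f fS; rewrite !inE.
  by case: eqP => //= /eqP fb; apply: contraL fS => fT; apply: cutS_T.
have [/andP[/set0Pn[g gC] /existsP[S' /eqP CS']] _] := minsetP cocC.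
have T_side X v w : (forall f, f \in T -> f \notin cut G X) ->
    (v \in X) = (w \in X).
  by move/adjacent_side; apply; apply: tree_connected treeT.
have CNT f : f \in C -> f != b -> f \notin T.
  by move=> fC fb; move: (subsetP CT f fC); rewrite !inE (negPf fb).
have bC : b \in C.
  apply: contraT => bC; move: gC.
  rewrite CS' mem_cut (T_side S' (src D g) (tgt D g)) ?addbb // => f fT.
  rewrite -CS'; apply/negP => fC; case: (f =P b) => [fb|/eqP fb].
    by rewrite -fb fC in bC.
  by move: (CNT f fC fb); rewrite fT.
rewrite /smallest bC /=; apply/forall_inP/idP => [minC|/bS {}bS f fC].
  apply/negP => /(adjacent_side (S := S')) side.
  move: bC; rewrite CS' mem_cut side ?addbb // => f fN.
  rewrite -CS'; apply/negP=> fC.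
  move: fN; rewrite inE ltNge minC //= => /andP[fb].
  by apply/negP/CNT.
rewrite leNgt; apply/negP => fb.
(* X is crossed by f, but not by the edges of the connected graph T. *)
pose X := [set v | (v \in S) (+) (v \in S')].
have XE h : (h \in cut G X) = (h \in cut G S) (+) (h \in C).
  have inX z : (z \in X) = (z \in S) (+) (z \in S') by rewrite inE.
  by rewrite CS' !mem_cut !inX addbACA.
have: f \in cut G X.
  by rewrite XE fC (negPf (NS f _)) // inE fb.
rewrite mem_cut (T_side X (src D f) (tgt D f)) ?addbb // => h hT.
rewrite XE; case: (h =P b) => [->|/eqP hb]; first by rewrite bS bC.
rewrite (negPf (cutS_T _ hT hb)) /=.
by apply: contraL hT => hC; apply: CNT.
Qed.

End SpanningTrees.

(** * The two ends of the interpolation *)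

Section Endpoints.
Variables (V : finType) (disp : Order.disp_t) (E : finOrderType disp).
Variables (G : mgraph V E) (D : digraph V E).
Variables (R : comNzRingType) (x u y v : R).
Hypothesis orientD : orientation G D.
Implicit Types (A B C T : {set E}).

Lemma prod_set (z : R) (P : pred E) :
  \prod_e (if P e then z else 1) = z ^+ #|[set e | P e]|.
Proof.
rewrite -big_mkcond prodr_const; congr (_ ^+ _).
by apply: eq_card => e; rewrite inE.
Qed.

Lemma total_weight_oriented A :
  total_weight D x u y v set0 A =
  x ^+ #|Theta_dual D A| * u ^+ #|Theta_dual_bar D A| *
  y ^+ #|Theta D A| * v ^+ #|Theta_bar D A|.
Proof.
have setE (B : {set E}) (z : R) : z ^+ #|B| = \prod_e (if e \in B then z else 1).
  by rewrite -big_mkcond prodr_const.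
rewrite !setE -!big_split; apply: eq_bigr => e _ /=.
rewrite /Theta_dual /Theta_dual_bar /Theta /Theta_bar !in_setD !in_setI.
rewrite mem_Oset mem_Oset_dual !closes_reorient /weight in_set0 /=.
have := @closes_impl _ _ _ D (state set0 A) (e, e \notin A).
case: (closes D false _ _); case: (closes D true _ _) => impl;
  try (by have := impl isT); by case: (e \in A); rewrite /= ?mulr1 ?mul1r.
Qed.

Lemma total_weight_tree T : spanning_tree G T ->
  total_weight D x u y v setT T =
  (x + u) ^+ int_activity G T * (y + v) ^+ ext_activity G T.
Proof.
move=> treeT; rewrite /int_activity /ext_activity -!prod_set -big_split.
apply: eq_bigr => e _ /=; rewrite /weight !in_setT /=.
rewrite !(closes_tree orientD) in_setC.
case: (boolP (e \in T)) => eT /=; rewrite ?mulr1 ?mul1r.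
  rewrite (int_activeE orientD treeT eT).
  rewrite (tree_unlinked orientD treeT eT) /=; last first.
    by apply/subsetP => f; rewrite tree_minor0 !inE => /andP[/gt_eqF-> ->].
  by rewrite if_neg.
rewrite (ext_activeE orientD treeT eT) /act_weight; case: ifP => // _.
rewrite ifT //; apply: adjacent_sub (tree_connected _ _ treeT).
apply/subsetP=> f fT; have fe : f != e by apply: contraNneq eT => <-.
by rewrite inE fT fe if_same.
Qed.

Lemma total_weight0 A e : weight D x u y v setT A e = 0 ->
  total_weight D x u y v setT A = 0.
Proof. by rewrite /total_weight (bigD1 e) //= => ->; rewrite mul0r. Qed.

(** The smallest edge of a cut that avoids [A] is a deleted isthmus. *)
Lemma total_weight_disconnected A : connected G -> ~~ connects G A ->
  total_weight D x u y v setT A = 0.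
Proof.
move=> connG /forallPn[s /forallPn[t nst]].
pose S := [set z | connect (adjacent G A) s z].
have AS f : f \in A -> f \notin cut G S by apply: component_cut.
have [f0 f0S] : exists f, f \in cut G S.
  apply/set0Pn; apply: contraNneq nst => S0.
  have /forallP/(_ s)/forallP/(_ t) := connG.
  move/(adjacent_side (S := S)); rewrite S0 !inE connect0 => <- // f _.
  by rewrite inE.
case: (Order.TotalTheory.arg_minP (P := mem (cut G S)) id f0S) => e eS min_e.
have {}eS : e \in cut G S by [].
have eA : e \notin A by apply: contraL eS => /AS.
apply: (@total_weight0 _ e).
rewrite /weight !in_setT (negPf eA) /= !(closes_tree orientD) /act_weight.
set b1 := connect _ _ _; set b2 := connect _ _ _.
have b2F : b2 = false.
  apply/negP => /(adjacent_side (S := S)) side; move: eS.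
  rewrite (mem_cut orientD) side ?addbb // => f; rewrite inE.
  case: ltP => [fe _|_ /andP[_ /AS //]].
  by apply: contraL fe => /min_e; rewrite leNgt.
have: b1 -> b2.
  apply: adjacent_sub; apply/subsetP => f.
  by rewrite tree_minor0 inE => /andP[ef ->]; rewrite (gt_eqF ef); case: ifP.
by rewrite b2F; case: b1 => // /(_ isT).
Qed.

(** The smallest edge of a cycle in [A] is a contracted loop. *)
Lemma total_weight_cyclic A C : C \subset A -> gcycle G C ->
  total_weight D x u y v setT A = 0.
Proof.
move=> CA cycC; have [f0 f0C] : exists f, f \in C.
  case/existsP: cycC => p /and5P[pn _ _ _ /eqP->].
  by case: p pn => -[|z p] //= _ _; exists z.2; rewrite !inE eqxx.
case: (Order.TotalTheory.arg_minP (P := mem C) id f0C) => e eC min_e.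
have {}eC : e \in C by [].
apply: (@total_weight0 _ e).
rewrite /weight !in_setT (subsetP CA _ eC) /= !(closes_tree orientD) /act_weight.
rewrite ifT //; apply: adjacent_sub (gcycle_linked orientD cycC eC).
apply/subsetP=> f; rewrite tree_minor0 !inE => /andP[fe fC].
by rewrite lt_neqAle eq_sym fe min_e // (subsetP CA).
Qed.

Lemma spanning_tree_expansion : connected G ->
  \sum_(T | spanning_tree G T)
    (x + u) ^+ int_activity G T * (y + v) ^+ ext_activity G T =
  \sum_(A : {set E})
    x ^+ #|Theta_dual D A| * u ^+ #|Theta_dual_bar D A| *
    y ^+ #|Theta D A| * v ^+ #|Theta_bar D A|.
Proof.
move=> connG; under [RHS]eq_bigr do rewrite -total_weight_oriented.
rewrite total_weight_transfer big_mkcond; apply: eq_bigr => T _; case: ifPn.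
  by move/total_weight_tree.
rewrite negb_and => /orP[/(total_weight_disconnected connG) //|].
case/forallPn=> C; rewrite negb_imply negbK => /andP[CT].
by move/(total_weight_cyclic CT).
Qed.

End Endpoints.

Lemma tutte_sum_trees (V : finType) (disp : Order.disp_t) (E : finOrderType disp)
    (G : mgraph V E) :
  tutte G = \sum_(T | spanning_tree G T)
    'X_(@Ordinal 2 0 isT) ^+ int_activity G T *
    'X_(@Ordinal 2 1 isT) ^+ ext_activity G T.
Proof.
rewrite /tutte.
have le_act (B : {set E}) : (#|B| < #|E|.+1)%N by rewrite ltnS max_card.
rewrite (partition_big (fun T : {set E} =>
  Ordinal (le_act [set b in T | smallest (fund_cocycle G T b) b])) predT) //=.
apply: eq_bigr => i _.
rewrite (partition_big (fun T : {set E} =>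
  Ordinal (le_act [set e in ~: T | smallest (fund_cycle G T e) e])) predT) //=.
apply: eq_bigr => j _.
rewrite (eq_bigr (fun=> 'X_(@Ordinal 2 0 isT) ^+ i *
  'X_(@Ordinal 2 1 isT) ^+ j)); last first.
  by move=> T /andP[/andP[_ /eqP <-] /eqP <-].
rewrite sumr_const -mulrA mulr_natl; congr (_ *+ _); apply: eq_card => T.
by rewrite inE unfold_in -!val_eqE andbA.
Qed.

Theorem theorem3p22 (V : finType) (disp : Order.disp_t) (E : finOrderType disp)
    (G : mgraph V E) (D : digraph V E)
    (connG : connected G) (orientD : orientation G D) :
  let x : {mpoly int[4]} := 'X_(@Ordinal 4 0 isT) in
  let u : {mpoly int[4]} := 'X_(@Ordinal 4 1 isT) in
  let y : {mpoly int[4]} := 'X_(@Ordinal 4 2 isT) in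
  let v : {mpoly int[4]} := 'X_(@Ordinal 4 3 isT) in
  tutte G \mPo [tuple x + u; y + v] =
  \sum_(A : {set E})
    x ^+ #|Theta_dual D A| * u ^+ #|Theta_dual_bar D A| *
    y ^+ #|Theta D A| * v ^+ #|Theta_bar D A|.
Proof.
move=> x u y v; rewrite -(spanning_tree_expansion _ _ _ _ orientD connG).
rewrite tutte_sum_trees raddf_sum /=; apply: eq_bigr => T _.
by rewrite rmorphM !rmorphXn /= !comp_mpolyXU.
Qed.
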